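(* Let $(\mathbb{I},J)$ be the almost-complex Iwasawa manifold described in the context. Then $h^{1,0}_{\mathrm{Dol}}=1$ (spanned by $\varphi^3$), $h^{2,0}_{\mathrm{Dol}}=1$ (spanned by $i\varphi^1\wedge\varphi^3+\varphi^2\wedge\varphi^3$), and $h^{3,0}_{\mathrm{Dol}}=0$.
   Context: General notions. For an almost-complex manifold $(X,J)$, $A^k(X)=\bigoplus_{p+q=k}A^{p,q}(X)$ and $d=\mu+\partial+\overline{\partial}+\bar\mu$ with $\mu:A^{p,q}\to A^{p+2,q-1}$, $\partial:A^{p,q}\to A^{p+1,q}$, $\overline{\partial}:A^{p,q}\to A^{p,q+1}$, $\bar\mu:A^{p,q}\to A^{p-1,q+2}$. The almost-complex Dolbeault cohomology (of Cirici–Wilson) in bidegree $(p,0)$ is $H^{p,0}_{\mathrm{Dol}}(X)=\{\psi\in A^{p,0}(X):\overline{\partial}\psi=0,\ \bar\mu\psi=0\}$, and $h^{p,0}_{\mathrm{Dol}}$ is its complex dimension. The Iwasawa manifold. $\mathbb{H}_3$ is the complex Heisenberg group of matrices $\begin{pmatrix}1&z_1&z_3\\0&1&z_2\\0&0&1\end{pmatrix}$, $z_j=x_j+iy_j\in\mathbb{C}$, $\Gamma\subset\mathbb{H}_3$ the subgroup with $z_1,z_2,z_3\in\mathbb{Z}[i]$, and $\mathbb{I}=\Gamma\backslash\mathbb{H}_3$. Left-invariant real $1$-forms: $e^1=dx_1$, $e^2=dy_1$, $e^3=dx_2$, $e^4=dy_2$, $e^5=dx_3-x_1dx_2+y_1dy_2$,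 $e^6=dy_3-x_1dy_2-y_1dx_2$, with $de^1=\dots=de^4=0$, $de^5=-e^{13}+e^{24}$, $de^6=-e^{14}-e^{23}$. $J$ is the almost-complex structure whose $(1,0)$-forms are spanned by $\varphi^1=e^1+ie^6$, $\varphi^2=e^2+ie^5$, $\varphi^3=e^3+ie^4$. *)

(* Defs.v *)
From HB Require Import structures.
From mathcomp Require Import all_boot all_order all_algebra.
From mathcomp Require Import all_classical all_reals all_analysis.
From mathcomp Require Import complex.
Unset Printing Implicit Defensive.
Import Order.TTheory GRing.Theory Num.Theory.
Local Open Scope ring_scope.

(* Points of the complex Heisenberg group H_3, in real coordinates
   (x1,y1,x2,y2,x3,y3) = (p 0, p 1, p 2, p 3, p 4, p 5). *)
Notation pt R := 'rV[R]_6.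
Definition crd {R : realType} (p : pt R) (i : 'I_6) : R := p ord0 i.

Definition mkpt {R : realType} (a0 a1 a2 a3 a4 a5 : R) : pt R :=
  \row_(i < 6) nth 0 [:: a0; a1; a2; a3; a4; a5] i.

(* Left multiplication by g = (z1,z2,z3), z_j = a_j + i b_j, in the Heisenberg
   group: (z1,z2,z3)(w1,w2,w3) = (z1+w1, z2+w2, z3+w3 + z1 w2). *)
Definition hmul {R : realType} (g p : pt R) : pt R :=
  let g := crd g in let p := crd p in
  mkpt (g 0 + p 0) (g 1 + p 1) (g 2 + p 2) (g 3 + p 3)
       (g 4 + p 4 + (g 0 * p 2 - g 1 * p 3))
       (g 5 + p 5 + (g 0 * p 3 + g 1 * p 2)).

Definition in_Gamma {R : realType} (g : pt R) : Prop :=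
  forall i : 'I_6, exists k : int, crd g i = k%:~R.

(* A function on the Iwasawa manifold = a Gamma-invariant function on H_3. *)
Definition Gamma_invariant {R : realType} (f : pt R -> R[i]) : Prop :=
  forall g p, in_Gamma g -> f (hmul g p) = f p.

Definition unitv (R : realType) (i : 'I_6) : pt R := \row_(j < 6) (i == j)%:R.

Definition pdR {R : realType} (i : 'I_6) (f : pt R -> R) : pt R -> R :=
  fun p => 'D_(unitv R i) f p.

Definition iter_pd {R : realType} (s : seq 'I_6) (f : pt R -> R) : pt R -> R :=
  foldr (fun i g => pdR i g) f s.

(* C^infty real function: every iterated partial derivative (of every order,
   including order 0) is (Frechet) differentiable everywhere; this is
   equivalent to all iterated partials existing and being continuous. *)
Definition smoothR {R : realType} (f : pt R -> R) : Prop :=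
  forall (s : seq 'I_6) p, differentiable (iter_pd s f) p.

Definition smoothC {R : realType} (f : pt R -> R[i]) : Prop :=
  smoothR (fun p => complex.Re (f p)) /\ smoothR (fun p => complex.Im (f p)).

Definition pd {R : realType} (i : 'I_6) (f : pt R -> R[i]) : pt R -> R[i] :=
  fun p => (pdR i (fun q => complex.Re (f q)) p)%:C%C
           + 'i%C * (pdR i (fun q => complex.Im (f q)) p)%:C%C.

(* Left-invariant real frame E_1..E_6 (indices 0..5) dual to e^1..e^6:
   E1 = d/dx1, E2 = d/dy1, E3 = d/dx2 + x1 d/dx3 + y1 d/dy3,
   E4 = d/dy2 - y1 d/dx3 + x1 d/dy3, E5 = d/dx3, E6 = d/dy3. *)
Definition Efield {R : realType} (k : 'I_6) (f : pt R -> R[i]) : pt R -> R[i] :=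
  fun p =>
    let x := fun i => (crd p i)%:C%C in
    match val k with
    | 2 => pd 2 f p + x 0 * pd 4 f p + x 1 * pd 5 f p
    | 3 => pd 3 f p - x 1 * pd 4 f p + x 0 * pd 5 f p
    | _ => pd k f p
    end.

(* Complex coframe omega^0..omega^5 = phi^1, phi^2, phi^3, conj phi^1,
   conj phi^2, conj phi^3, with phi^1 = e^1 + i e^6, phi^2 = e^2 + i e^5,
   phi^3 = e^3 + i e^4.  Dual frame W_k:
   W_0 = (E1 - i E6)/2, W_1 = (E2 - i E5)/2, W_2 = (E3 - i E4)/2,
   W_3 = (E1 + i E6)/2, W_4 = (E2 + i E5)/2, W_5 = (E3 + i E4)/2. *)
Definition Wfield {R : realType} (k : 'I_6) (f : pt R -> R[i]) : pt R -> R[i] :=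
  fun p =>
    let E := fun j : nat => Efield (inord j) f p in
    match val k with
    | 0 => (E 0 - 'i%C * E 5) / 2%:R
    | 1 => (E 1 - 'i%C * E 4) / 2%:R
    | 2 => (E 2 - 'i%C * E 3) / 2%:R
    | 3 => (E 0 + 'i%C * E 5) / 2%:R
    | 4 => (E 1 + 'i%C * E 4) / 2%:R
    | _ => (E 2 + 'i%C * E 3) / 2%:R
    end.

(* Complex differential forms on H_3 written in the coframe omega:
   alpha = sum_S alpha S * omega^S, omega^S the increasing wedge. *)
Definition cform (R : realType) := {set 'I_6} -> pt R -> R[i].

Definition wsign (R : realType) (S T : {set 'I_6}) : R[i] :=
  (-1) ^+ #|[set q : 'I_6 * 'I_6 | (q.1 \in S) && (q.2 \in T) && (q.2 < q.1)%N]|.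

Definition wedge {R : realType} (a b : cform R) : cform R :=
  fun U p => \sum_(S : {set 'I_6}) \sum_(T : {set 'I_6} |
                 [disjoint S & T] && (S :|: T == U))
               wsign R S T * a S p * b T p.

Definition fzero (R : realType) : cform R := fun _ _ => 0.
Definition fadd {R : realType} (a b : cform R) : cform R := fun U p => a U p + b U p.
Definition fscale {R : realType} (c : R[i]) (a : cform R) : cform R :=
  fun U p => c * a U p.
Definition fmulfun {R : realType} (f : pt R -> R[i]) (a : cform R) : cform R :=
  fun U p => f p * a U p.

Definition obasis (R : realType) (S : {set 'I_6}) : cform R :=
  fun U _ => if U == S then 1 else 0.
Definition om (R : realType) (k : 'I_6) : cform R := obasis R [set k].

(* real coframe e^1..e^6 expressed in omega:
   e^1 = (w0+w3)/2, e^6 = -i(w0-w3)/2, e^2 = (w1+w4)/2, e^5 = -i(w1-w4)/2,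
   e^3 = (w2+w5)/2, e^4 = -i(w2-w5)/2. *)
Definition halfC (R : realType) : R[i] := 2%:R^-1.
Definition ereal1 (R : realType) (a b : nat) : cform R :=
  fscale (halfC R) (fadd (om R (inord a)) (om R (inord b))).
Definition ereal2 (R : realType) (a b : nat) : cform R :=
  fscale (- 'i%C * halfC R) (fadd (om R (inord a)) (fscale (-1) (om R (inord b)))).
Definition e1 R := ereal1 R 0 3.  Definition e6 R := ereal2 R 0 3.
Definition e2 R := ereal1 R 1 4.  Definition e5 R := ereal2 R 1 4.
Definition e3 R := ereal1 R 2 5.  Definition e4 R := ereal2 R 2 5.

(* structure equations: de^1 = .. = de^4 = 0,
   de^5 = -e^13 + e^24, de^6 = -e^14 - e^23 *)
Definition de5 (R : realType) : cform R :=
  fadd (fscale (-1) (wedge (e1 R) (e3 R))) (wedge (e2 R) (e4 R)).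
Definition de6 (R : realType) : cform R :=
  fadd (fscale (-1) (wedge (e1 R) (e4 R))) (fscale (-1) (wedge (e2 R) (e3 R))).

(* d omega^k: dphi^1 = de^1 + i de^6, dphi^2 = de^2 + i de^5,
   dphi^3 = de^3 + i de^4, and conjugates. *)
Definition dom (R : realType) (k : 'I_6) : cform R :=
  match val k with
  | 0 => fscale 'i%C (de6 R)
  | 1 => fscale 'i%C (de5 R)
  | 3 => fscale (- 'i%C) (de6 R)
  | 4 => fscale (- 'i%C) (de5 R)
  | _ => fzero R
  end.

Fixpoint wlist (R : realType) (s : seq 'I_6) : cform R :=
  match s with
  | [::] => obasis R (@finset.set0 _)
  | k :: s' => wedge (om R k) (wlist R s')
  end.
Fixpoint dwlist (R : realType) (s : seq 'I_6) : cform R :=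
  match s with
  | [::] => fzero R
  | k :: s' => fadd (wedge (dom R k) (wlist R s'))
                    (fscale (-1) (wedge (om R k) (dwlist R s')))
  end.
Definition dbasis (R : realType) (S : {set 'I_6}) : cform R :=
  dwlist R (sort (fun a b : 'I_6 => (a <= b)%N) (enum S)).

Definition dform {R : realType} (a : cform R) : cform R :=
  fun U p => \sum_(S : {set 'I_6})
     ( \sum_(k : 'I_6) Wfield k (a S) p * wedge (om R k) (obasis R S) U p
       + a S p * dbasis R S U p ).

Definition lowI : {set 'I_6} := [set i : 'I_6 | (i < 3)%N].
Definition pdeg (S : {set 'I_6}) : nat := #|S :&: lowI|.
Definition qdeg (S : {set 'I_6}) : nat := #|S :\: lowI|.

Definition is_form_pq {R : realType} (p q : nat) (a : cform R) : Prop :=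
  (forall S, smoothC (a S) /\ Gamma_invariant (a S)) /\
  (forall S, (pdeg S != p) || (qdeg S != q) -> forall x, a S x = 0).

(* for a (p,q)-cform a:  dbar a = (p,q+1)-component of da,
   mubar a = (p-1,q+2)-component of da (zero when p = 0). *)
Definition dbar {R : realType} (p q : nat) (a : cform R) : cform R :=
  fun U x => if (pdeg U == p) && (qdeg U == q.+1) then dform a U x else 0.
Definition mubar {R : realType} (p q : nat) (a : cform R) : cform R :=
  fun U x => if (pdeg U).+1 == p then (if qdeg U == q.+2 then dform a U x else 0) else 0.

Definition H_Dol_p0 {R : realType} (p : nat) (a : cform R) : Prop :=
  is_form_pq p 0 a /\ (forall U x, dbar p 0 a U x = 0) /\ (forall U x, mubar p 0 a U x = 0).

Definition phi3 (R : realType) : cform R := om R (inord 2).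
Definition psi2 (R : realType) : cform R :=
  fadd (fscale 'i%C (wedge (om R (inord 0)) (om R (inord 2))))
       (wedge (om R (inord 1)) (om R (inord 2))).

(* Main.v *)
Require Import Defs.
From HB Require Import structures.
From mathcomp Require Import all_boot all_order all_algebra.
From mathcomp Require Import all_classical all_reals all_analysis.
From mathcomp Require Import complex.
From mathcomp Require Import ring lra.
Import Order.TTheory GRing.Theory Num.Theory.
Import numFieldNormedType.Exports.
Local Open Scope ring_scope.

(* Linear algebra in the coframe reduces every case to functions whose
   derivatives W_3, W_4, W_5 along the (0,1)-frame are constant, constant and 0.
   Since E_5, E_6 are central, 2 W_3 = d/dx1 + i d/dy3 is a Cauchy-Riemann
   operator, so the real and imaginary parts u of such a function are harmonic in
   (x1, y3).  For d >= 0 the Gamma-invariant function u^2 + d u_y^2 attains its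
   maximum; there its Laplacian, which is at least 2 u_y^2, is nonpositive, so
   u_y = 0 at the maximum and d u_y^2 <= max u^2 everywhere.  Letting d grow gives
   u_y = 0.  The same argument applies to W_4 in (y1, x3), and then to W_5, which has
   become a Cauchy-Riemann operator in (x2, y2). *)

(** * Calculus along lines *)

(** The linear algebra rests on mubar being linear over functions. The structure equations give
    mubar phi^1 = (conj phi^13 - i conj phi^23) / 4, mubar phi^2 = - i mubar phi^1 and mubar phi^3 =
    0. So the kernel of mubar is spanned by i phi^1 + phi^2 and phi^3 in degree 1, by (i phi^1 +
    phi^2) ^ phi^3 in degree 2, and is zero in degree 3. This is where the generator in degree 2
    comes from, and at most two unknown functions remain. In degree 1 the coefficient of phi^2 is
    shown to be constant and then enters the equations for the coefficient of phi^3 as a constant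
    source; this is why constant, and not only zero, derivatives must be handled. The analytic
    obstacle is that each operator sees only two of the six directions. A maximum principle applied
    to u alone speaks only of the leaf through the maximum point. The term d u_y^2, with d
    arbitrarily large, yields a bound at every point instead. *)

Lemma is_derive_line {R : realType} {V : normedModType R} (f : V -> R) (p v : V) (t : R) :
  derivable f (p + t *: v) v ->
  is_derive t (1 : R) (fun s : R => f (p + s *: v)) ('D_v f (p + t *: v)).
Proof.
have E : (fun h : R => h^-1 *: (f (p + (h *: (1 : R) + t) *: v) - f (p + t *: v)))
   = (fun h : R => h^-1 *: (f (h *: v + (p + t *: v)) - f (p + t *: v))).
  apply/boolp.funext => h; congr (_ *: (f _ - _)).
  rewrite scalerDl addrCA; congr (_ *: _ + _).
  by rewrite /GRing.scale /= mulr1.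
by move=> df; split; [rewrite /derivable /= E|rewrite /derive /= E].
Qed.

Lemma first_derivative_test {R : realType} (f : R -> R) (c : R) :
  (forall t : R, derivable f t (1 : R)) -> is_derive (0 : R) (1 : R) f c ->
  (forall t, f t <= f 0) -> c = 0.
Proof.
move=> df dc fmax.
have i0 : (0 : R) \in `]-1, 1[ by rewrite in_itv /= ltrN10 ltr01.
have H : is_derive (0 : R) (1 : R) f 0.
  apply: (@derive1_at_max _ f (-1) 1 0) i0 _.
  - lra.
  - by move=> t _; exact: df.
  - by move=> t _; exact: fmax.
by rewrite -(@derive_val _ _ _ _ _ _ _ dc) (@derive_val _ _ _ _ _ _ _ H).
Qed.

(** If [c > 0], then [f'], which vanishes at the maximum 0, is positive just to the right of 0, and
    the mean value theorem puts [f] above [f 0] there. *)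
Lemma second_derivative_test {R : realType} (f f' : R -> R) (c : R) :
  (forall t : R, is_derive t (1 : R) f (f' t)) -> is_derive (0 : R) (1 : R) f' c ->
  (forall t, f t <= f 0) -> c <= 0.
Proof.
move=> df ddf fmax.
have f'0 : f' 0 = 0.
  by apply: (first_derivative_test _ _ _ (df 0) fmax) => t; case: (df t).
rewrite leNgt; apply/negP => c0.
have dd := @ex_derive _ _ _ _ _ _ _ ddf; have Dc := @derive_val _ _ _ _ _ _ _ ddf.
have cvgc : ((fun h : R =>
    (h^-1 *: ((f' \o shift 0) (h *: (1 : R)) - f' 0))%R) @ (0%R : R)^' --> c)%classic.
  by rewrite -Dc; exact: dd.
move/cvgrPdist_lt: cvgc => /(_ c c0).
rewrite near_withinE => /nbhs_ballP [e /= e0 He].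
have e20 : 0 < e / 2 by rewrite divr_gt0.
have := @MVT _ f f' _ _ e20 (fun t _ => df t).
case; first by apply: derivable_within_continuous => t _; case: (df t).
move=> x; rewrite in_itv /= => /andP[x0 xe] E.
have : 0 < f' x.
  have := He x; rewrite /ball /= sub0r normrN gtr0_norm// => /(_ _ _).
  have xe' : x < e by lra.
  move=> /(_ xe' (lt0r_neq0 x0)).
  rewrite f'0 subr0 addr0 /GRing.scale /= mulr1 => H.
  have : 0 < x^-1 * f' x by move: H; rewrite ltr_norml => /andP[_]; lra.
  by rewrite pmulr_rgt0 // invr_gt0.
move=> f'x; have := fmax (e / 2).
have : 0 < f' x * (e / 2 - 0) by rewrite subr0 mulr_gt0.
by rewrite -E; lra.
Qed.

Lemma derive2_at_max {R : realType} {V : normedModType R} (f : V -> R) (p v : V) :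
  (forall q, derivable f q v) -> (forall q, derivable ('D_v f) q v) ->
  (forall q, f q <= f p) -> 'D_v ('D_v f) p <= 0.
Proof.
move=> df ddf fmax.
have := @second_derivative_test R (fun s => f (p + s *: v)) (fun s => 'D_v f (p + s *: v)).
apply.
- by move=> t; exact: is_derive_line.
- by have := @is_derive_line _ _ ('D_v f) p v 0 (ddf _); rewrite scale0r addr0.
- by move=> t; rewrite scale0r addr0.
Qed.

(** The mean value theorem is used twice: in direction [v] for the increment of [f] over [h *: w],
    then in direction [w] for ['D_v f]. The left side is symmetric in [v] and [w], which is what
    [schwarz] exploits. *)
Lemma second_difference {R : realType} {V : normedModType R} (f : V -> R) (p v w : V) (h : R) :
  (forall q, derivable f q v) -> (forall q, derivable ('D_v f) q w) -> 0 < h ->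
  exists x y : R, [/\ 0 < x < h, 0 < y < h &
   f (p + h *: v + h *: w) - f (p + h *: v) - f (p + h *: w) + f p =
   h ^+ 2 * 'D_w ('D_v f) (p + x *: v + y *: w)].
Proof.
move=> df ddf h0.
pose g (s : R) := f (p + h *: w + s *: v) - f (p + s *: v).
pose g' (s : R) := 'D_v f (p + h *: w + s *: v) - 'D_v f (p + s *: v).
have dg (t : R) : is_derive t (1 : R) g (g' t).
  by apply: is_deriveB; apply: is_derive_line.
have [|x xi Ex] := @MVT _ g g' _ _ h0 (fun t _ => dg t).
  by apply: derivable_within_continuous => t _; case: (dg t).
have dk (t : R) : is_derive t (1 : R)
    (fun s => 'D_v f (p + x *: v + s *: w)) ('D_w ('D_v f) (p + x *: v + t *: w)).
  exact: is_derive_line.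
have [|y yi Ey] := @MVT _ _ _ _ _ h0 (fun t _ => dk t).
  by apply: derivable_within_continuous => t _; case: (dk t).
exists x, y; split; rewrite ?in_itv /= in xi yi *; [exact: xi|exact: yi|].
move: Ex Ey; rewrite /g /g' !scale0r !addr0 !subr0.
rewrite (addrAC p (h *: w) (x *: v)) (addrAC p (h *: w) (h *: v)) => E1 E2.
rewrite E2 in E1.
rewrite expr2 -mulrA [h * (h * _)]mulrC [h * _]mulrC -E1.
by rewrite opprB addrA addrAC.
Qed.

Lemma half_dist_absurd {R : realType} (a b c c' : R) :
  `|a - c| < `|a - b| / 2 -> `|b - c'| < `|a - b| / 2 -> c = c' -> False.
Proof.
move=> h1 h2 cc; have := ltrD h1 h2; rewrite -splitr -cc (distrC b).
move=> h; have := lt_le_trans h (ler_distD c a b).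
by rewrite ltxx.
Qed.

(** One second difference, evaluated in both orders, equates a value of ['D_w ('D_v f)] with a value
    of ['D_v ('D_w f)] at two points near [p]; continuity at [p] then excludes a gap. *)
Lemma schwarz {R : realType} {V : normedModType R} (f : V -> R) (p v w : V) :
  (forall q, derivable f q v) -> (forall q, derivable f q w) ->
  (forall q, derivable ('D_v f) q w) -> (forall q, derivable ('D_w f) q v) ->
  {for p, continuous ('D_w ('D_v f))} -> {for p, continuous ('D_v ('D_w f))} ->
  'D_w ('D_v f) p = 'D_v ('D_w f) p.
Proof.
move=> dv dw dvw dwv cA cB.
set A := 'D_w ('D_v f) in cA *; set B := 'D_v ('D_w f) in cB *.
apply/eqP; rewrite -subr_eq0 -normr_le0 leNgt; apply/negP => e0.
set e := `|_| in e0.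
have e20 : 0 < e / 2 by rewrite divr_gt0.
move/cvgrPdist_lt: cA => /(_ _ e20); move=> /nbhs_ballP [d1 /= d10 H1].
move/cvgrPdist_lt: cB => /(_ _ e20); move=> /nbhs_ballP [d2 /= d20 H2].
pose d := Num.min d1 d2.
have d0 : 0 < d by rewrite lt_min d10 d20.
(* This keeps [x *: v + y *: w] shorter than [d] for all [x] and [y] between 0 and [h]; the summand
   1 covers [v = w = 0]. *)
pose h := d / (`|v| + `|w| + 1).
have n0 : 0 < `|v| + `|w| + 1 by rewrite ltr_wpDl // addr_ge0.
have h0 : 0 < h by rewrite divr_gt0.
have near x y : 0 < x < h -> 0 < y < h -> `|p - (p + x *: v + y *: w)| < d.
  move=> /andP[x0 xh] /andP[y0 yh].
  rewrite -addrA opprD addNKr normrN (le_lt_trans (ler_normD _ _)) // !normrZ !gtr0_norm //.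
  have -> : d = h * (`|v| + `|w| + 1) by rewrite /h divfK // gt_eqF.
  rewrite 2!mulrDr mulr1.
  have := ler_wpM2r (normr_ge0 v) (ltW xh); have := ler_wpM2r (normr_ge0 w) (ltW yh).
  by lra.
have [x [y [xi yi E]]] := @second_difference _ _ f p v w h dv dvw h0.
have [x' [y' [xi' yi' E']]] := @second_difference _ _ f p w v h dw dwv h0.
have h2 : h ^+ 2 != 0 by rewrite expf_neq0 // gt_eqF.
have EAB : A (p + x *: v + y *: w) = B (p + x' *: w + y' *: v).
  apply: (mulfI h2); apply: etrans (esym E) (etrans _ E').
  by rewrite (addrAC p (h *: w)); congr (_ + f p); exact: addrAC.
have a1 : `|A p - A (p + x *: v + y *: w)| < e / 2.
  apply: H1; rewrite -ball_normE /=; apply: lt_le_trans (near _ _ xi yi) _.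
  by rewrite ge_min lexx.
have a2 : `|B p - B (p + x' *: w + y' *: v)| < e / 2.
  apply: H2; rewrite -ball_normE /= addrAC; apply: lt_le_trans (near _ _ yi' xi') _.
  by rewrite ge_min lexx orbT.
exact: (@half_dist_absurd _ _ _ _ _ a1 a2 EAB).
Qed.

Lemma derive_at_max {R : realType} {V : normedModType R} (f : V -> R) (p v : V) :
  (forall q, derivable f q v) -> (forall q, f q <= f p) -> 'D_v f p = 0.
Proof.
move=> df fmax.
apply: (@first_derivative_test R (fun s => f (p + s *: v))).
- by move=> t; have [] := @is_derive_line _ _ f p v t (df _).
- by have := @is_derive_line _ _ f p v 0 (df _); rewrite scale0r addr0.
- by move=> t; rewrite scale0r addr0.
Qed.

Lemma constant_line {R : realType} {V : normedModType R} (f : V -> R) (v : V) :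
  (forall q, derivable f q v) -> (forall q, 'D_v f q = 0) ->
  forall p t, f (p + t *: v) = f p.
Proof.
move=> df f0 p t.
rewrite -[in RHS](addr0 p) -(scale0r v).
apply: (@is_derive_0_is_cst R (fun s => f (p + s *: v)) t 0) => x.
by have := @is_derive_line _ _ f p v x (df _); rewrite f0.
Qed.

(** * Harmonic functions on the quotient *)

Lemma smoothR_pdR {R : realType} (j : 'I_6) (u : pt R -> R) : smoothR u -> smoothR (pdR j u).
Proof. by move=> su s p; have := su (rcons s j) p; rewrite /iter_pd foldr_rcons. Qed.

Lemma smoothR_derivable {R : realType} (u : pt R -> R) : smoothR u -> forall p v, derivable u p v.
Proof. by move=> su p v; apply: diff_derivable; exact: (su [::]). Qed.

Lemma smoothR_continuous {R : realType} (u : pt R -> R) : smoothR u -> continuous u.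
Proof. by move=> su p; apply: differentiable_continuous; exact: (su [::]). Qed.

Lemma pdR_comm {R : realType} (i j : 'I_6) (u : pt R -> R) : smoothR u ->
  pdR i (pdR j u) = pdR j (pdR i u).
Proof.
move=> su; apply/boolp.funext => p; apply: schwarz.
- by move=> q; exact: smoothR_derivable.
- by move=> q; exact: smoothR_derivable.
- by move=> q; apply: (smoothR_derivable (pdR j u)); exact: smoothR_pdR.
- by move=> q; apply: (smoothR_derivable (pdR i u)); exact: smoothR_pdR.
- by apply: (smoothR_continuous (pdR i (pdR j u))); do 2 apply: smoothR_pdR.
- by apply: (smoothR_continuous (pdR j (pdR i u))); do 2 apply: smoothR_pdR.
Qed.

Lemma pdR_add {R : realType} (i : 'I_6) (u w : pt R -> R) : smoothR u -> smoothR w ->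
  pdR i (fun p => u p + w p) = fun p => pdR i u p + pdR i w p.
Proof.
by move=> su sw; apply/boolp.funext => p; apply: deriveD; exact: smoothR_derivable.
Qed.

Lemma pdR_sub {R : realType} (i : 'I_6) (u w : pt R -> R) : smoothR u -> smoothR w ->
  pdR i (fun p => u p - w p) = fun p => pdR i u p - pdR i w p.
Proof.
by move=> su sw; apply/boolp.funext => p; apply: deriveB; exact: smoothR_derivable.
Qed.

Lemma pdR_cst {R : realType} (i : 'I_6) (c : R) : pdR i (fun=> c) = fun=> 0.
Proof. by apply/boolp.funext => p; exact: derive_cst. Qed.

(** The left side is half the second derivative of [u ^+ 2 + d * w ^+ 2] in direction [k]. *)
Lemma pdR2_sumsq_le0 {R : realType} (k : 'I_6) (d : R) (u w : pt R -> R) (p : pt R) :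
  smoothR u -> smoothR w ->
  (forall q, u q ^+ 2 + d * w q ^+ 2 <= u p ^+ 2 + d * w p ^+ 2) ->
  pdR k u p ^+ 2 + u p * pdR k (pdR k u) p
    + d * (pdR k w p ^+ 2 + w p * pdR k (pdR k w) p) <= 0.
Proof.
move=> su sw pmax.
have dsq (g h : pt R -> R) q : smoothR g -> smoothR h ->
    is_derive q (unitv R k) (fun q => g q * h q) (pdR k g q * h q + g q * pdR k h q).
  move=> sg sh.
  have dg := derivableP (smoothR_derivable g sg q (unitv R k)).
  have dh := derivableP (smoothR_derivable h sh q (unitv R k)).
  apply: is_derive_eq (is_deriveM dg dh) _.
  by rewrite addrC mulrC; congr (_ + _); exact: mulrC.
pose F q := u q * u q + d * (w q * w q).
pose F' q := 2 * (u q * pdR k u q) + (2 * d) * (w q * pdR k w q).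
have dF q : is_derive q (unitv R k) F (F' q).
  have H := is_deriveD (dsq _ _ q su su) (is_deriveZ d (dsq _ _ q sw sw)).
  by apply: is_derive_eq H _; rewrite /F' /GRing.scale /=; ring.
have sDu := smoothR_pdR k _ su; have sDw := smoothR_pdR k _ sw.
have EF : 'D_(unitv R k) F = F'.
  by apply/boolp.funext => q; exact: (@derive_val _ _ _ _ _ _ _ (dF q)).
have dF' q : is_derive q (unitv R k) F'
  (2 * (pdR k u q ^+ 2 + u q * pdR k (pdR k u) q)
    + (2 * d) * (pdR k w q ^+ 2 + w q * pdR k (pdR k w) q)).
  exact: is_deriveD (is_deriveZ 2 (dsq _ _ q su sDu)) (is_deriveZ (2 * d) (dsq _ _ q sw sDw)).
have : 'D_(unitv R k) ('D_(unitv R k) F) p <= 0.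
  apply: derive2_at_max => q; first by case: (dF q).
  - by rewrite EF; case: (dF' q).
  - by rewrite /F -!expr2; exact: pmax.
by rewrite EF (@derive_val _ _ _ _ _ _ _ (dF' p)) -(mulrA 2) -mulrDr pmulr_rle0.
Qed.

(** Adding the two inequalities cancels the second derivatives and leaves [ui ^+ 2 + w ^+ 2 + d *
    (wi ^+ 2 + wj ^+ 2) <= 0]. Here [w] is the [j]-derivative of [u], hence the term [w ^+ 2] in the
    second inequality. *)
Lemma maximum_point_aux {R : realType} (d u w ui wi wj uii ujj wii wjj : R) :
  0 <= d -> uii + ujj = 0 -> wii + wjj = 0 ->
  ui ^+ 2 + u * uii + d * (wi ^+ 2 + w * wii) <= 0 ->
  w ^+ 2 + u * ujj + d * (wj ^+ 2 + w * wjj) <= 0 -> w = 0.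
Proof.
move=> d0 /eqP; rewrite addrC addr_eq0 => /eqP -> /eqP; rewrite addrC addr_eq0 => /eqP ->.
move=> Hi Hj; apply/eqP; rewrite -sqrf_eq0 eq_le sqr_ge0 andbT.
have := sqr_ge0 ui; have := mulr_ge0 d0 (sqr_ge0 wi); have := mulr_ge0 d0 (sqr_ge0 wj).
by lra.
Qed.

Lemma bounded_multiples_eq0 {R : realType} (M b : R) :
  0 <= b -> (forall d, 0 <= d -> d * b <= M) -> b = 0.
Proof.
move=> b0 bM; apply/eqP; rewrite eq_le b0 andbT leNgt; apply/negP => bp.
have M0 : 0 <= M by have := bM 0 (lexx 0); rewrite mul0r.
have := bM ((M + 1) / b); rewrite divfK ?gt_eqF // divr_ge0 ?addr_ge0 //.
by move/(_ isT); lra.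
Qed.

(* Without this, unifying two iterated partial derivatives unfolds them to limits. *)
Local Opaque pdR.

Lemma harmonic_pdR_eq0 {R : realType} (i j : 'I_6) (u : pt R -> R) : smoothR u ->
  (forall p, pdR i (pdR i u) p + pdR j (pdR j u) p = 0) ->
  (forall d, 0 <= d -> exists p, forall q,
     u q ^+ 2 + d * pdR j u q ^+ 2 <= u p ^+ 2 + d * pdR j u p ^+ 2) ->
  forall p, pdR j u p = 0.
Proof.
move=> su harm maxi.
have si := smoothR_pdR i _ su; have sj := smoothR_pdR j _ su.
have harmj p : pdR i (pdR i (pdR j u)) p + pdR j (pdR j (pdR j u)) p = 0.
  have E0 := etrans (congr1 (pdR j) (boolp.funext harm)) (pdR_cst j 0).
  have E1 := pdR_add j _ _ (smoothR_pdR i _ si) (smoothR_pdR j _ sj).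
  rewrite (pdR_comm i j u su) (pdR_comm i j (pdR i u) si).
  by have := congr1 (fun f => f p) (etrans (esym E1) E0).
have w0 d : 0 <= d -> exists p, forall q, u q ^+ 2 + d * pdR j u q ^+ 2 <= u p ^+ 2.
  move=> d0; have [p pmax] := maxi d d0; exists p.
  suff wp0 : pdR j u p = 0 by move=> q; have := pmax q; rewrite wp0 expr0n mulr0 addr0.
  exact: (maximum_point_aux _ _ _ _ _ _ _ _ _ _ d0 (harm p) (harmj p)
    (pdR2_sumsq_le0 i d u _ p su sj pmax) (pdR2_sumsq_le0 j d u _ p su sj pmax)).
(* The maximum point [p] moves with [d]; the case [d = 0] bounds [u p ^+ 2] by a number independent
   of [d]. *)
have [m mmax] := w0 0 (lexx 0).
move=> q; apply/eqP; rewrite -sqrf_eq0; apply/eqP.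
apply: (@bounded_multiples_eq0 _ (u m ^+ 2)); first exact: sqr_ge0.
move=> d d0; have [p pmax] := w0 d d0.
have := le_trans (pmax q) (le_trans _ (mmax p)); rewrite mul0r addr0 => /(_ (lexx _)).
by apply: le_trans; rewrite lerDr sqr_ge0.
Qed.

(** * Compactness of the quotient and invariance of partial derivatives *)

Definition Gamma_invariantR {R : realType} (u : pt R -> R) : Prop :=
  forall g p, in_Gamma g -> u (hmul g p) = u p.

Lemma crd_mkpt {R : realType} (a0 a1 a2 a3 a4 a5 : R) (i : 'I_6) :
  crd (mkpt a0 a1 a2 a3 a4 a5) i = nth 0 [:: a0; a1; a2; a3; a4; a5] i.
Proof. by rewrite /crd /mkpt mxE. Qed.

Lemma ord6_ind (P : 'I_6 -> Prop) : P 0 -> P 1 -> P 2 -> P 3 -> P 4 -> P 5 -> forall i, P i.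
Proof.
move=> p0 p1 p2 p3 p4 p5 i.
have E (j : 'I_6) : val i = val j -> P j -> P i by move/val_inj ->.
case: i E => -[|[|[|[|[|[|//]]]]]] im E.
- exact: E p0.
- exact: E p1.
- exact: E p2.
- exact: E p3.
- exact: E p4.
- exact: E p5.
Qed.

Lemma fundamental_domain {R : realType} (p : pt R) :
  exists2 g, in_Gamma g & forall i, 0 <= crd (hmul g p) i <= 1.
Proof.
pose n (x : R) : int := - Num.floor x.
have nP x : 0 <= (n x)%:~R + x <= 1.
  rewrite /n rmorphN /= addrC subr_ge0 Num.Theory.floor_le /=.
  by have := floorD1_gt x; rewrite intrD1 => h; lra.
pose x i := crd p i.
pose m i : R := (n (x i))%:~R.
(* The first four entries of [g] shift the last two coordinates by these bilinear terms, so the last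
   two integers are chosen after them. *)
pose s4 := x 4 + (m 0 * x 2 - m 1 * x 3); pose s5 := x 5 + (m 0 * x 3 + m 1 * x 2).
exists (mkpt (m 0) (m 1) (m 2) (m 3) (n s4)%:~R (n s5)%:~R).
  by elim/ord6_ind; rewrite crd_mkpt; eexists.
by elim/ord6_ind; rewrite /hmul !crd_mkpt /= ?nP // -addrA nP.
Qed.

Lemma Gamma_invariantR_max {R : realType} (u : pt R -> R) :
  continuous u -> Gamma_invariantR u -> exists p, forall q, u q <= u p.
Proof.
move=> cu iu.
have cK := @rV_compact R 6 (fun=> `[(0 : R), 1]%classic) (fun=> @segment_compact R 0 1).
have [||p _ pmax] := @EVT_max_rV R 6 u _ _ cK.
- by exists 0 => i /=; rewrite mxE in_itv /= lexx ler01.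
- exact: continuous_subspaceT.
exists p => q; have [g gG gq] := fundamental_domain q.
rewrite -(iu g q gG); apply: pmax; rewrite inE => i /=.
by rewrite in_itv /=; exact: gq.
Qed.

Local Transparent pdR.

(** The hypothesis compares values of [u] instead of asking the translation to commute with
    [hmul g]. Along y2 the two do not commute, yet the hypothesis still holds for invariant
    functions constant along the centre. *)
Lemma Gamma_invariantR_pdR {R : realType} (j : 'I_6) (u : pt R -> R) :
  (forall g p t, in_Gamma g -> u (t *: unitv R j + hmul g p) = u (t *: unitv R j + p)) ->
  Gamma_invariantR (pdR j u).
Proof.
move=> H g p gG; rewrite /pdR /derive /=.
have H0 : u (hmul g p) = u p by have := H g p 0 gG; rewrite scale0r !add0r.
rewrite H0.
suff -> : (fun h : R => h^-1 *: ((u \o shift (hmul g p)) (h *: unitv R j) - u p)) =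
  (fun h => h^-1 *: ((u \o shift p) (h *: unitv R j) - u p)) by [].
by apply/boolp.funext => t /=; rewrite H.
Qed.

Lemma pdR_eq0_line {R : realType} (j : 'I_6) (u : pt R -> R) : smoothR u ->
  (forall p, pdR j u p = 0) -> forall p t, u (t *: unitv R j + p) = u p.
Proof.
move=> su u0 p t; rewrite addrC; apply: constant_line => q; last exact: u0.
exact: smoothR_derivable.
Qed.

Lemma pdR_max {R : realType} (j : 'I_6) (u : pt R -> R) p : smoothR u ->
  (forall q, u q <= u p) -> pdR j u p = 0.
Proof. by move=> su; apply: derive_at_max => q; exact: smoothR_derivable. Qed.

Local Opaque pdR.

Lemma hmul_line {R : realType} (j : 'I_6) (g p : pt R) t : (3 < j)%N ->
  t *: unitv R j + hmul g p = hmul g (t *: unitv R j + p).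
Proof.
move=> j3; apply/rowP => i; move: i.
elim/ord6_ind; rewrite /hmul /crd /mkpt /unitv !mxE /=; move: j3; elim/ord6_ind: j => //= _.
all: by rewrite ?eqE /= ?mulr0 ?mulr1 ?add0r //; ring.
Qed.

(** The bilinear term of the group law makes translation along y2 fail to commute with left
    multiplication. The defect is central, hence invisible to functions with vanishing x3- and
    y3-derivatives. *)
Lemma hmul_line3 {R : realType} (g p : pt R) t :
  t *: unitv R 3 + hmul g p =
  (t * crd g 1) *: unitv R 4 + (- (t * crd g 0) *: unitv R 5 + hmul g (t *: unitv R 3 + p)).
Proof.
apply/rowP => i; move: i.
by elim/ord6_ind; rewrite /hmul /crd /mkpt /unitv !mxE ?eqE /= ?mulr0 ?mulr1 ?add0r //; ring.
Qed.

Lemma constant_of_pdR {R : realType} (u : pt R -> R) : smoothR u ->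
  (forall i p, pdR i u p = 0) -> forall p, u p = u 0.
Proof.
move=> su u0 p.
have H (s : seq 'I_6) : u (\sum_(i <- s) p ord0 i *: unitv R i) = u 0.
  elim: s => [|i s IH]; first by rewrite big_nil.
  by rewrite big_cons pdR_eq0_line.
rewrite -(H (index_enum 'I_6)); congr u.
apply/rowP => j; rewrite summxE (bigD1 j) //= !mxE eqxx mulr1 big1 ?addr0 //.
by move=> i /negbTE ij; rewrite !mxE ij mulr0.
Qed.

(** Differentiating the equations removes [c1] and [c2] and makes [a] and [b] harmonic, so their
    [j]-derivatives vanish. Their [i]-derivatives then equal the constants [c1] and [c2], which are
    0 as seen at maximum points of [a] and [b]. *)
Lemma cauchy_riemann_eq0 {R : realType} (i j : 'I_6) (a b : pt R -> R) (c1 c2 : R) :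
  smoothR a -> smoothR b -> Gamma_invariantR a -> Gamma_invariantR b ->
  Gamma_invariantR (pdR j a) -> Gamma_invariantR (pdR j b) ->
  (forall p, pdR i a p - pdR j b p = c1) -> (forall p, pdR i b p + pdR j a p = c2) ->
  [/\ c1 = 0, c2 = 0, (forall p, pdR i a p = 0 /\ pdR j a p = 0) &
      forall p, pdR i b p = 0 /\ pdR j b p = 0].
Proof.
move=> sa sb ia ib ija ijb e1 e2.
have maxi (u : pt R -> R) : smoothR u -> Gamma_invariantR u -> Gamma_invariantR (pdR j u) ->
    forall d, 0 <= d -> exists p, forall q,
     u q ^+ 2 + d * pdR j u q ^+ 2 <= u p ^+ 2 + d * pdR j u p ^+ 2.
  move=> su iu iju d _.
  apply: (@Gamma_invariantR_max _ (fun q => u q ^+ 2 + d * pdR j u q ^+ 2)).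
    move=> q; have du := su [::] q; have dw := smoothR_pdR j _ su [::] q.
    exact: differentiable_continuous (differentiableD (differentiableM du du)
      (differentiableZ d (differentiableM dw dw))).
  by move=> g q gG; rewrite iu // iju.
have cstD (c : R) (u w : pt R -> R) k : smoothR u -> smoothR w ->
    (forall p, u p + w p = c) -> forall p, pdR k u p + pdR k w p = 0.
  move=> su sw uw p.
  have := etrans (esym (pdR_add k _ _ su sw)) (etrans (congr1 (pdR k) (boolp.funext uw)) (pdR_cst k c)).
  by move/(congr1 (fun f => f p)).
have cstB (c : R) (u w : pt R -> R) k : smoothR u -> smoothR w ->
    (forall p, u p - w p = c) -> forall p, pdR k u p - pdR k w p = 0.
  move=> su sw uw p.
  have := etrans (esym (pdR_sub k _ _ su sw)) (etrans (congr1 (pdR k) (boolp.funext uw)) (pdR_cst k c)).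
  by move/(congr1 (fun f => f p)).
have harma p : pdR i (pdR i a) p + pdR j (pdR j a) p = 0.
  have := cstB _ _ _ i (smoothR_pdR i _ sa) (smoothR_pdR j _ sb) e1 p.
  have := cstD _ _ _ j (smoothR_pdR i _ sb) (smoothR_pdR j _ sa) e2 p.
  rewrite (pdR_comm i j b sb); move: (pdR _ _ _) (pdR _ _ _) (pdR _ _ _) => x y z.
  by lra.
have harmb p : pdR i (pdR i b) p + pdR j (pdR j b) p = 0.
  have := cstB _ _ _ j (smoothR_pdR i _ sa) (smoothR_pdR j _ sb) e1 p.
  have := cstD _ _ _ i (smoothR_pdR i _ sb) (smoothR_pdR j _ sa) e2 p.
  rewrite (pdR_comm i j a sa); move: (pdR _ _ _) (pdR _ _ _) (pdR _ _ _) => x y z.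
  by lra.
have ja := harmonic_pdR_eq0 i j a sa harma (maxi a sa ia ija).
have jb := harmonic_pdR_eq0 i j b sb harmb (maxi b sb ib ijb).
have ei p : pdR i a p = c1 by have := e1 p; rewrite jb subr0.
have ei' p : pdR i b p = c2 by have := e2 p; rewrite ja addr0.
have [p pmax] := Gamma_invariantR_max a (smoothR_continuous _ sa) ia.
have [q qmax] := Gamma_invariantR_max b (smoothR_continuous _ sb) ib.
have c10 : c1 = 0 by rewrite -(ei p) pdR_max.
have c20 : c2 = 0 by rewrite -(ei' q) pdR_max.
by split => // r; rewrite ?ei ?ei' ?c10 ?c20.
Qed.

(** * Constant-coefficient forms as lists of Gaussian integers *)

Notation bits := (seq bool).

(** Membership vectors allow index sets to be handled by evaluation; fixing the length at 6 makes
    the encoding injective. *)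
Definition setb (b : bits) : {set 'I_6} := [set i : 'I_6 | nth false b i].
Definition bits_of (S : {set 'I_6}) : bits := [seq i \in S | i <- enum 'I_6].

Lemma size_bits_of S : size (bits_of S) = 6%N.
Proof. by rewrite size_map size_enum_ord. Qed.

Lemma bits_ofK S : setb (bits_of S) = S.
Proof.
by apply/setP => i; rewrite inE (nth_map i) ?size_enum_ord // nth_ord_enum.
Qed.

Lemma setb_inj b c : size b = 6%N -> size c = 6%N -> setb b = setb c -> b = c.
Proof.
move=> sb sc bc; apply: (@eq_from_nth _ false); rewrite sb ?sc // => i i6.
by have /setP /(_ (Ordinal i6)) := bc; rewrite !inE.
Qed.

Fixpoint all_bits (n : nat) : seq bits :=
  if n is n'.+1 then [seq x :: s | x <- [:: true; false], s <- all_bits n'] else [:: [::]].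

Arguments all_bits : simpl never.

Lemma mem_all_bits n b : (b \in all_bits n) = (size b == n).
Proof.
elim: n b => [|n IH] b; first by rewrite inE; case: b.
rewrite /all_bits -/all_bits /=.
rewrite cats0 mem_cat; case: b => [|x b].
  by apply/negbTE; rewrite negb_or; apply/andP; split; apply/mapP => -[].
rewrite /= eqSS -IH; case: x.
  rewrite (mem_map (@can_inj _ _ (cons true) behead _)) // orbC.
  by case: (boolP (_ \in map _ _)) => // /mapP [].
rewrite (mem_map (@can_inj _ _ (cons false) behead _)) //.
by case: (boolP (_ \in map _ _)) => // /mapP [].
Qed.

Lemma big_set_bits (V : nmodType) (F : {set 'I_6} -> V) :
  \sum_S F S = \sum_(b <- all_bits 6) F (setb b).
Proof.
rewrite -(big_map setb xpredT F); apply: perm_big; apply: uniq_perm.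
- exact: index_enum_uniq.
- rewrite map_inj_in_uniq; first by vm_compute.
  by move=> b c; rewrite !mem_all_bits => /eqP sb /eqP sc; exact: setb_inj.
- move=> S; rewrite mem_index_enum; apply/esym/mapP; exists (bits_of S).
    by rewrite mem_all_bits size_bits_of.
  by rewrite bits_ofK.
Qed.

Lemma big_ord_iota (V : nmodType) (F : nat -> V) n :
  \sum_(i < n) F i = \sum_(i <- iota 0 n) F i.
Proof. by rewrite -(big_mkord xpredT) /index_iota subn0. Qed.

Definition inversions (b c : bits) : nat :=
  sumn [seq sumn [seq (nth false b i && nth false c j && (j < i)%N : nat) | j <- iota 0 6]
           | i <- iota 0 6].
Definition disjointb (b c : bits) : bool :=
  all (fun i => ~~ (nth false b i && nth false c i)) (iota 0 6).
Definition orb_bits (b c : bits) : bits :=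
  [seq nth false b i || nth false c i | i <- iota 0 6].

Lemma wsign_setb (R : realType) b c : wsign R (setb b) (setb c) = (-1) ^+ inversions b c.
Proof.
congr (_ ^+ _); rewrite -sum1_card big_mkcond /=.
pose F (i j : 'I_6) := (nth false b i && nth false c j && (j < i)%N : nat).
rewrite (eq_bigr (fun q => F q.1 q.2)); last first.
  by move=> [i j] _; rewrite !inE /F /=; case: ifP.
rewrite -(pair_bigA _ F) /= /inversions sumnE big_map -big_ord_iota.
by apply: eq_bigr => i _; rewrite sumnE big_map -big_ord_iota.
Qed.

Lemma disjoint_setb b c : [disjoint setb b & setb c] = disjointb b c.
Proof.
apply/pred0P/allP => H i.
  by rewrite mem_iota => i6; have := H (Ordinal i6); rewrite /= !inE => ->.
by rewrite /= !inE; apply/negbTE/H; rewrite mem_iota ltn_ord.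
Qed.

Lemma setU_setb b c : setb b :|: setb c = setb (orb_bits b c).
Proof.
by apply/setP => i; rewrite !inE (nth_map 0%N) ?size_iota // nth_iota.
Qed.

Lemma wedge_obasis (R : realType) b c :
  wedge (obasis R (setb b)) (obasis R (setb c)) =
  fscale (if disjointb b c then (-1) ^+ inversions b c else 0) (obasis R (setb (orb_bits b c))).
Proof.
apply/boolp.funext => U; apply/boolp.funext => p; rewrite /wedge (bigD1 (setb b)) //=.
rewrite [X in _ + X]big1 => [|S /negbTE Sb]; last first.
  by apply: big1 => T _; rewrite /obasis Sb mulr0 mul0r.
rewrite addr0 big_mkcond (bigD1 (setb c)) //= [X in _ + X]big1 => [|T /negbTE Tc]; last first.
  by rewrite /obasis Tc mulr0 if_same.
rewrite addr0 disjoint_setb setU_setb /fscale /obasis !eqxx wsign_setb !mulr1 (eq_sym U).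
by case: (disjointb b c); case: eqP; rewrite ?mulr1 ?mulr0 ?mul0r.
Qed.

(** * Formal sums of basis wedges over the Gaussian integers *)

Notation gint := (int * int)%type.
Definition gadd (x y : gint) : gint := (x.1 + y.1, x.2 + y.2).
Definition gmul (x y : gint) : gint := (x.1 * y.1 - x.2 * y.2, x.1 * y.2 + x.2 * y.1).

Definition gval (R : realType) (x : gint) : R[i] := x.1%:~R + 'i%C * x.2%:~R.

Lemma mulii (R : realType) : 'i%C * 'i%C = -1 :> R[i].
Proof. by rewrite -expr2 sqr_i. Qed.

Lemma gvalD (R : realType) x y : gval R (gadd x y) = gval R x + gval R y.
Proof. by rewrite /gval !rmorphD /= mulrDr addrACA. Qed.

Lemma gvalM (R : realType) x y : gval R (gmul x y) = gval R x * gval R y.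
Proof.
rewrite /gval rmorphB rmorphD !rmorphM /=.
move: (x.1%:~R) (x.2%:~R) (y.1%:~R) (y.2%:~R) => a b c d.
have -> : (a + 'i%C * b) * (c + 'i%C * d) = a * c + 'i%C * (a * d + b * c) + 'i%C * 'i%C * (b * d).
  by ring.
by rewrite mulii; ring.
Qed.

(** An index set may occur in several entries; [lcoef] adds them up. *)
Definition lform := seq (gint * bits).

Definition lfval (R : realType) (L : lform) : cform R :=
  fun U p => \sum_(x <- L) gval R x.1 * obasis R (setb x.2) U p.

Definition lwedge (L M : lform) : lform :=
  [seq (gmul ((if disjointb x.2 y.2 then (-1) ^+ inversions x.2 y.2 else 0), 0)
         (gmul x.1 y.1), orb_bits x.2 y.2) | x <- L, y <- M].
Definition lscale (c : gint) (L : lform) : lform := [seq (gmul c x.1, x.2) | x <- L].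
Definition lcoef (L : lform) (u : bits) : gint :=
  foldr (fun x s => if x.2 == u then gadd x.1 s else s) (0, 0) L.
Arguments lwedge : simpl never.
Arguments lscale : simpl never.
Definition lwf (L : lform) : bool := all (fun x => size x.2 == 6%N) L.

Lemma lfval_cat (R : realType) L M : lfval R (L ++ M) = fadd (lfval R L) (lfval R M).
Proof.
by apply/boolp.funext => U; apply/boolp.funext => p; rewrite /lfval big_cat.
Qed.

Lemma lfval_scale (R : realType) c L : lfval R (lscale c L) = fscale (gval R c) (lfval R L).
Proof.
apply/boolp.funext => U; apply/boolp.funext => p.
rewrite /lfval /fscale big_map mulr_sumr; apply: eq_bigr => x _.
by rewrite gvalM mulrA.
Qed.

Lemma lfval_wedge (R : realType) L M : lfval R (lwedge L M) = wedge (lfval R L) (lfval R M).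
Proof.
apply/boolp.funext => U; apply/boolp.funext => p.
rewrite /lfval /lwedge big_allpairs_dep /wedge.
transitivity (\sum_(x <- L) \sum_(y <- M) gval R x.1 * gval R y.1 *
   wedge (obasis R (setb x.2)) (obasis R (setb y.2)) U p).
  apply: eq_bigr => x _; apply: eq_bigr => y _.
  rewrite !gvalM wedge_obasis /fscale [RHS]mulrCA [RHS]mulrA; congr (_ * _ * _).
  by rewrite /gval /= mulr0 addr0; case: ifP => _; rewrite ?rmorphXn ?rmorphN1.
rewrite /wedge.
under eq_bigr => x _ do under eq_bigr => y _ do rewrite mulr_sumr.
under eq_bigr => x _ do rewrite exchange_big.
rewrite exchange_big; apply: eq_bigr => S _ /=.
under eq_bigr => x _ do under eq_bigr => y _ do rewrite mulr_sumr.
under eq_bigr => x _ do rewrite exchange_big.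
rewrite exchange_big; apply: eq_bigr => T _ /=.
rewrite -mulrA mulr_suml mulr_sumr; apply: eq_bigr => x _.
rewrite !mulr_sumr; apply: eq_bigr => y _.
by ring.
Qed.

Lemma lfval_coef (R : realType) L u p : lwf L -> size u = 6%N ->
  lfval R L (setb u) p = gval R (lcoef L u).
Proof.
move=> wL su; rewrite /lfval; elim: L wL => [|x L IH] /=.
  by rewrite big_nil /gval mulr0 addr0.
case/andP => /eqP sx wL; rewrite big_cons IH // /obasis.
case: (eqVneq x.2 u) => [->|xu]; first by rewrite eqxx mulr1 gvalD.
by case: eqP => [/setb_inj E|]; [rewrite E ?eqxx // in xu|rewrite mulr0 add0r].
Qed.

(** * The structure equations in evaluable form *)

Definition one_hot (k : nat) : bits := [seq j == k | j <- iota 0 6].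
Definition lom (k : nat) : lform := [:: ((1, 0), one_hot k)].

Lemma one_hotE (k : 'I_6) : [set k] = setb (one_hot k).
Proof.
by apply/setP => i; rewrite !inE (nth_map 0%N) ?size_iota // nth_iota.
Qed.

Lemma lfval1 (R : realType) b : lfval R [:: ((1, 0), b)] = obasis R (setb b).
Proof.
apply/boolp.funext => U; apply/boolp.funext => p.
by rewrite /lfval big_seq1 /gval /= mulr0 addr0 mul1r.
Qed.

Lemma om_lom (R : realType) (k : 'I_6) : om R k = lfval R (lom k).
Proof. by rewrite lfval1 /om one_hotE. Qed.

Definition lcoframe_re (a b : nat) : lform := lom a ++ lom b.
Definition lcoframe_im (a b : nat) : lform := lscale (0, -1) (lom a ++ lscale (-1, 0) (lom b)).
(* Represents twice the real coframe element e^k, 1 <= k <= 4. *)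
Definition lcoframe (k : nat) : lform :=
  match k with
  | 1 => lcoframe_re 0 3
  | 2 => lcoframe_re 1 4
  | 3 => lcoframe_re 2 5
  | _ => lcoframe_im 2 5
  end.

Definition lde5 : lform :=
  lscale (-1, 0) (lwedge (lcoframe 1) (lcoframe 3)) ++ lwedge (lcoframe 2) (lcoframe 4).
Definition lde6 : lform :=
  lscale (-1, 0) (lwedge (lcoframe 1) (lcoframe 4)) ++ lscale (-1, 0) (lwedge (lcoframe 2) (lcoframe 3)).
(* Represents four times [dom]. *)
Definition ldom (k : nat) : lform :=
  match k with
  | 0 => lscale (0, 1) lde6
  | 1 => lscale (0, 1) lde5
  | 3 => lscale (0, -1) lde6
  | 4 => lscale (0, -1) lde5
  | _ => [::]
  end.

Lemma gval_m1 (R : realType) : gval R (-1, 0) = -1.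
Proof. by rewrite /gval /= mulr0 addr0 rmorphN1. Qed.

Lemma gval_i (R : realType) : gval R (0, 1) = 'i%C.
Proof. by rewrite /gval /= mulr1 add0r. Qed.

Lemma gval_mi (R : realType) : gval R (0, -1) = - 'i%C.
Proof. by rewrite /gval /= rmorphN1 mulrN1 add0r. Qed.

Lemma fscaleA (R : realType) c d (A : cform R) : fscale c (fscale d A) = fscale (c * d) A.
Proof. by apply/boolp.funext => U; apply/boolp.funext => p; rewrite /fscale mulrA. Qed.

Lemma fscaleD (R : realType) c (A B : cform R) :
  fscale c (fadd A B) = fadd (fscale c A) (fscale c B).
Proof. by apply/boolp.funext => U; apply/boolp.funext => p; rewrite /fscale /fadd mulrDr. Qed.

Lemma wedge_scale (R : realType) c d (A B : cform R) :
  wedge (fscale c A) (fscale d B) = fscale (c * d) (wedge A B).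
Proof.
apply/boolp.funext => U; apply/boolp.funext => p; rewrite /wedge /fscale.
rewrite mulr_sumr; apply: eq_bigr => S _; rewrite mulr_sumr; apply: eq_bigr => T _.
by ring.
Qed.

Lemma fscale1 (R : realType) (A : cform R) : fscale 1 A = A.
Proof. by apply/boolp.funext => U; apply/boolp.funext => p; rewrite /fscale mul1r. Qed.

Lemma ereal1_lcoframe (R : realType) (a b : 'I_6) :
  fscale (halfC R) (fadd (om R a) (om R b)) = fscale (halfC R) (lfval R (lcoframe_re a b)).
Proof. by rewrite !om_lom lfval_cat. Qed.

Lemma ereal2_lcoframe (R : realType) (a b : 'I_6) :
  fscale (- 'i%C * halfC R) (fadd (om R a) (fscale (-1) (om R b))) =
  fscale (halfC R) (lfval R (lcoframe_im a b)).
Proof. by rewrite !om_lom lfval_scale lfval_cat lfval_scale gval_m1 gval_mi fscaleA mulrC. Qed.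

(** The coframe is doubled to keep every evaluated coefficient in the Gaussian integers; a wedge of
    two of its elements therefore owes this factor. *)
Definition quarter (R : realType) : R[i] := halfC R * halfC R.

Lemma coframe_lcoframe (R : realType) : [/\ e1 R = fscale (halfC R) (lfval R (lcoframe 1)),
  e2 R = fscale (halfC R) (lfval R (lcoframe 2)), e3 R = fscale (halfC R) (lfval R (lcoframe 3)) &
  e4 R = fscale (halfC R) (lfval R (lcoframe 4))].
Proof.
split.
- by rewrite /e1 /ereal1 ereal1_lcoframe !inordK.
- by rewrite /e2 /ereal1 ereal1_lcoframe !inordK.
- by rewrite /e3 /ereal1 ereal1_lcoframe !inordK.
- by rewrite /e4 /ereal2 ereal2_lcoframe !inordK.
Qed.

Lemma de5_lde5 (R : realType) : de5 R = fscale (quarter R) (lfval R lde5).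
Proof.
have [E1 E2 E3 E4] := coframe_lcoframe R.
rewrite /de5 E1 E2 E3 E4 !wedge_scale /lde5 lfval_cat fscaleD lfval_scale !lfval_wedge.
by rewrite gval_m1 !fscaleA mulrC.
Qed.

Lemma de6_lde6 (R : realType) : de6 R = fscale (quarter R) (lfval R lde6).
Proof.
have [E1 E2 E3 E4] := coframe_lcoframe R.
rewrite /de6 E1 E2 E3 E4 !wedge_scale /lde6 lfval_cat fscaleD.
rewrite (lfval_scale _ _ (lwedge (lcoframe 1) _)) (lfval_scale _ _ (lwedge (lcoframe 2) _)) !lfval_wedge.
by rewrite gval_m1 !fscaleA mulrC.
Qed.

Lemma lfval0 (R : realType) : lfval R [::] = fzero R.
Proof. by apply/boolp.funext => U; apply/boolp.funext => p; rewrite /lfval big_nil. Qed.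

Lemma fscale_fzero (R : realType) c : fscale c (fzero R) = fzero R.
Proof. by apply/boolp.funext => U; apply/boolp.funext => p; rewrite /fscale mulr0. Qed.

Lemma dom_ldom (R : realType) (k : 'I_6) : dom R k = fscale (quarter R) (lfval R (ldom k)).
Proof.
rewrite /dom de5_lde5 de6_lde6.
by case: k => -[|[|[|[|[|[|//]]]]]] _ /=;
  rewrite ?lfval0 ?fscale_fzero // lfval_scale ?gval_i ?gval_mi !fscaleA mulrC.
Qed.

(** The position 6 is out of range, so [one_hot 6] is the all-false vector and encodes the empty
    wedge. *)
Fixpoint lwlist (s : seq nat) : lform :=
  if s is k :: s' then lwedge (lom k) (lwlist s') else [:: ((1, 0), one_hot 6)].
Fixpoint ldwlist (s : seq nat) : lform :=
  if s is k :: s' then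
    lwedge (ldom k) (lwlist s') ++ lscale (-1, 0) (lwedge (lom k) (ldwlist s'))
  else [::].
Definition ldbasis (b : bits) : lform := ldwlist [seq k <- iota 0 6 | nth false b k].

Lemma wlist_lwlist (R : realType) (s : seq 'I_6) : wlist R s = lfval R (lwlist (map val s)).
Proof.
elim: s => [|k s IH] /=; last by rewrite IH om_lom lfval_wedge.
rewrite lfval1; congr (obasis R _); apply/setP => i; rewrite !inE.
by case: i => -[|[|[|[|[|[|//]]]]]].
Qed.

Lemma dwlist_ldwlist (R : realType) (s : seq 'I_6) :
  dwlist R s = fscale (quarter R) (lfval R (ldwlist (map val s))).
Proof.
elim: s => [|k s IH] /=; first by rewrite lfval0 fscale_fzero.
rewrite IH om_lom wlist_lwlist dom_ldom lfval_cat fscaleD lfval_scale !lfval_wedge.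
(* [wedge_scale] expects a scalar on each factor, so the missing ones are written as 1. *)
rewrite -[X in wedge _ X]fscale1 -[X in wedge X (fscale (quarter R) _)]fscale1.
by rewrite !wedge_scale mulr1 mul1r gval_m1 !fscaleA mulrC.
Qed.

(** The enumeration of a set of ordinals is already increasing, so sorting changes nothing. *)
Lemma sorted_enum_setb b :
  map val (sort (fun i j : 'I_6 => (i <= j)%N) (enum (setb b))) =
  [seq k <- iota 0 6 | nth false b k].
Proof.
have E : map val (enum (setb b)) = [seq k <- iota 0 6 | nth false b k].
  rewrite -val_enum_ord filter_map enumT /(enum (setb b)) /enum_mem; congr (map val _).
  by apply: eq_filter => i /=; rewrite inE.
rewrite sorted_sort //.
  by move=> x y z; exact: leq_trans.
have -> : sorted (fun i j : 'I_6 => (i <= j)%N) (enum (setb b)) = sorted leq (map val (enum (setb b))).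
  by rewrite sorted_map.
rewrite E.
by apply: (sorted_filter leq_trans); exact: iota_sorted.
Qed.

Lemma dbasis_setb (R : realType) b :
  dbasis R (setb b) = fscale (quarter R) (lfval R (ldbasis b)).
Proof. by rewrite /dbasis dwlist_ldwlist sorted_enum_setb. Qed.

Lemma lwf_cat L M : lwf (L ++ M) = lwf L && lwf M.
Proof. exact: all_cat. Qed.

Definition ord6 : seq 'I_6 := [:: 0; 1; 2; 3; 4; 5].

Lemma big_ord6 (V : nmodType) (F : 'I_6 -> V) : \sum_k F k = \sum_(k <- ord6) F k.
Proof.
rewrite !big_ord_recl big_ord0 !big_cons big_nil.
by do ! congr (_ + _); congr F; apply: val_inj.
Qed.

Lemma dform_setb (R : realType) (a : cform R) u p : size u = 6%N ->
  dform a (setb u) p = \sum_(b <- all_bits 6)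
    (\sum_(k <- ord6) Wfield k (a (setb b)) p * gval R (lcoef (lwedge (lom k) [:: ((1, 0), b)]) u)
     + a (setb b) p * (quarter R * gval R (lcoef (ldbasis b) u))).
Proof.
move=> su; rewrite /dform big_set_bits; apply: eq_big_seq => b.
rewrite mem_all_bits => /eqP sb.
have wfW L M : lwf (lwedge L M).
  by apply/allP => x /allpairsPdep [y [z [_ _ ->]]]; rewrite size_map size_iota.
have wfS c L : lwf L -> lwf (lscale c L).
  by move=> /allP wL; apply/allP => x /mapP [y yL ->]; exact: (wL y).
have wfD s : lwf (ldwlist s).
  by case: s => //= k s; rewrite lwf_cat wfW wfS.
rewrite big_ord6; congr (_ + _ * _).
  by apply: eq_bigr => k _; rewrite om_lom -lfval1 -lfval_wedge lfval_coef.
by rewrite dbasis_setb /fscale lfval_coef //; exact: wfD.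
Qed.

Definition pbits (b : bits) : nat := count id (take 3 b).
Definition qbits (b : bits) : nat := count id (drop 3 b).

Lemma pqdeg_setb b : size b = 6%N -> pdeg (setb b) = pbits b /\ qdeg (setb b) = qbits b.
Proof.
have cardE (A : {set 'I_6}) : #|A| = (\sum_(k <- ord6) (k \in A))%N.
  rewrite -sum1_card big_mkcond /= -(@big_ord6 nat (fun k => (k \in A) : nat)).
  by apply: eq_bigr => k _; case: (k \in A).
case: b => [|b0 [|b1 [|b2 [|b3 [|b4 [|b5 [|//]]]]]]] // _.
rewrite /pdeg /qdeg !cardE !big_cons !big_nil !inE /=.
by rewrite !andbT !andbF /pbits /qbits /=.
Qed.

(** * Functions with constant antiholomorphic derivatives *)

Notation ReF f := (fun p => complex.Re (f p)).
Notation ImF f := (fun p => complex.Im (f p)).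

Lemma pdE {R : realType} (i : 'I_6) (f : pt R -> R[i]) p :
  pd i f p = Complex (pdR i (ReF f) p) (pdR i (ImF f) p).
Proof.
rewrite /pd; move: (pdR i _ p) (pdR i _ p) => x y.
by apply/eqP; rewrite eq_complex /= !mul0r !mul1r subr0 addr0 !add0r !eqxx.
Qed.

Local Opaque pd.

Lemma Efield_horizontal {R : realType} (f : pt R -> R[i]) p :
  pd 4 f p = 0 -> pd 5 f p = 0 -> Efield 2 f p = pd 2 f p /\ Efield 3 f p = pd 3 f p.
Proof.
rewrite /Efield /= => -> ->; move: (pd 2 f p) (pd 3 f p) => A B.
by rewrite !mulr0 subr0 !addr0.
Qed.

Lemma WfieldE {R : realType} (f : pt R -> R[i]) p :
  [/\ Wfield 3 f p = (pd 0 f p + 'i%C * pd 5 f p) / 2%:R,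
      Wfield 4 f p = (pd 1 f p + 'i%C * pd 4 f p) / 2%:R &
      Wfield 5 f p = (Efield 2 f p + 'i%C * Efield 3 f p) / 2%:R].
Proof.
have io (k : 'I_6) : inord k = k by apply: val_inj; rewrite /= inordK.
have i0 := io 0; have i1 := io 1; have i2 := io 2; have i3 := io 3; have i4 := io 4.
have i5 := io 5; rewrite /= in i0 i1 i2 i3 i4 i5.
by rewrite /Wfield /= i0 i1 i2 i3 i4 i5; split.
Qed.

Lemma Wfield_cst {R : realType} (k : 'I_6) (c : R[i]) p : Wfield k (fun=> c) p = 0.
Proof.
have pd0 j : pd j (fun=> c) p = 0.
  by rewrite pdE !pdR_cst.
have E0 j : Efield j (fun=> c) p = 0.
  by rewrite /Efield !pd0 !mulr0 subr0 !addr0; case: (val j) => [|[|[|[|]]]].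
by rewrite /Wfield !E0 mulr0 subr0 addr0 mul0r; case: (val k) => [|[|[|[|[|]]]]].
Qed.

Lemma real_CR {R : realType} (x y z w : R) (c : R[i]) :
  (Complex x y + 'i%C * Complex z w) / 2%:R = c ->
  x - w = complex.Re (c * 2%:R) /\ y + z = complex.Im (c * 2%:R).
Proof.
move=> <-; rewrite divfK ?pnatr_eq0 //=.
by rewrite !mul0r !mul1r sub0r add0r.
Qed.

Lemma Gamma_invariant_Re {R : realType} (f : pt R -> R[i]) :
  Gamma_invariant f -> Gamma_invariantR (ReF f) /\ Gamma_invariantR (ImF f).
Proof. by move=> inv; split => g p gG; rewrite inv. Qed.

(** The order is forced: W_3 and W_4 remove the y3- and x3-derivatives, and only then are the
    y2-derivatives of the real and imaginary parts known to be invariant, as the treatment of W_5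
    requires. *)
Lemma W_const {R : realType} (f : pt R -> R[i]) (c3 c4 : R[i]) :
  smoothC f -> Gamma_invariant f -> (forall p, Wfield 3 f p = c3) ->
  (forall p, Wfield 4 f p = c4) -> (forall p, Wfield 5 f p = 0) ->
  [/\ c3 = 0, c4 = 0 & forall p, f p = f 0].
Proof.
move=> [sa sb] inv W3 W4 W5; have [ia ib] := Gamma_invariant_Re f inv.
have central (j : 'I_6) (u : pt R -> R) : (3 < j)%N -> Gamma_invariantR u -> Gamma_invariantR (pdR j u).
  by move=> j3 iu; apply: Gamma_invariantR_pdR => g p t gG; rewrite hmul_line // iu.
have c2_eq0 (c : R[i]) : complex.Re (c * 2%:R) = 0 -> complex.Im (c * 2%:R) = 0 -> c = 0.
  move=> re im; apply: (@mulIf _ 2%:R); first by rewrite pnatr_eq0.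
  by rewrite mul0r; apply/eqP; rewrite eq_complex re im !eqxx.
have cr3 p : pdR 0 (ReF f) p - pdR 5 (ImF f) p = complex.Re (c3 * 2%:R) /\
             pdR 0 (ImF f) p + pdR 5 (ReF f) p = complex.Im (c3 * 2%:R).
  by have [E _ _] := WfieldE f p; have := etrans (esym E) (W3 p); rewrite !pdE => /real_CR.
have cr4 p : pdR 1 (ReF f) p - pdR 4 (ImF f) p = complex.Re (c4 * 2%:R) /\
             pdR 1 (ImF f) p + pdR 4 (ReF f) p = complex.Im (c4 * 2%:R).
  by have [_ E _] := WfieldE f p; have := etrans (esym E) (W4 p); rewrite !pdE => /real_CR.
have [re3 im3 a05 b05] := cauchy_riemann_eq0 0 5 _ _ _ _ sa sb ia ib
  (central 5 _ isT ia) (central 5 _ isT ib) (fun p => (cr3 p).1) (fun p => (cr3 p).2).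
have [re4 im4 a14 b14] := cauchy_riemann_eq0 1 4 _ _ _ _ sa sb ia ib
  (central 4 _ isT ia) (central 4 _ isT ib) (fun p => (cr4 p).1) (fun p => (cr4 p).2).
have pd0 (i : 'I_6) p : pdR i (ReF f) p = 0 -> pdR i (ImF f) p = 0 -> pd i f p = 0.
  by move=> re im; rewrite pdE re im.
have cr5 p : pdR 2 (ReF f) p - pdR 3 (ImF f) p = 0 /\
             pdR 2 (ImF f) p + pdR 3 (ReF f) p = 0.
  (* Without central derivatives, E_3 and E_4 act on [f] as d/dx2 and d/dy2. *)
  suff : (pd 2 f p + 'i%C * pd 3 f p) / 2%:R = 0.
    by rewrite !pdE => /real_CR; rewrite mul0r.
  have [_ _ E5] := WfieldE f p.
  have [E2 E3] := Efield_horizontal f p (pd0 4 p (a14 p).2 (b14 p).2) (pd0 5 p (a05 p).2 (b05 p).2).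
  by rewrite -E2 -E3 -E5.
have i3 (u : pt R -> R) : smoothR u -> Gamma_invariantR u ->
    (forall p, pdR 4 u p = 0) -> (forall p, pdR 5 u p = 0) -> Gamma_invariantR (pdR 3 u).
  move=> su iu u4 u5; apply: Gamma_invariantR_pdR => g p t gG.
  by rewrite hmul_line3 (pdR_eq0_line 4 u su u4) (pdR_eq0_line 5 u su u5) iu.
have [_ _ a23 b23] := cauchy_riemann_eq0 2 3 _ _ _ _ sa sb ia ib
  (i3 _ sa ia (fun p => (a14 p).2) (fun p => (a05 p).2))
  (i3 _ sb ib (fun p => (b14 p).2) (fun p => (b05 p).2))
  (fun p => (cr5 p).1) (fun p => (cr5 p).2).
split; [exact: c2_eq0|exact: c2_eq0|move=> p].
have a0 i q : pdR i (ReF f) q = 0.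
  by elim/ord6_ind: i; case: (a05 q); case: (a14 q); case: (a23 q).
have b0 i q : pdR i (ImF f) q = 0.
  by elim/ord6_ind: i; case: (b05 q); case: (b14 q); case: (b23 q).
apply/eqP; rewrite eq_complex.
by rewrite (constant_of_pdR _ sa a0 p) (constant_of_pdR _ sb b0 p) !eqxx.
Qed.

(** * The Dolbeault groups *)

Definition bits_in (l : seq nat) : bits := [seq j \in l | j <- iota 0 6].
Arguments bits_in : simpl never.
Definition p0_bits (p : nat) : seq bits := [seq b <- all_bits 6 | (pbits b == p) && (qbits b == 0)].

(** These are the target bidegrees (p, 1) of dbar and (p - 1, 2) of mubar; the successor avoids
    truncated subtraction at [p = 0]. *)
Definition dbar_mubar_bits (p : nat) (u : bits) : bool :=
  (pbits u == p) && (qbits u == 1) || ((pbits u).+1 == p) && (qbits u == 2).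

(* The entry [(b, Some k, c)] stands for [c * W_k (a_b)] and [(b, None, c)] for [c / 4 * a_b]. *)
Definition dform_terms (p : nat) (u : bits) : seq (bits * option nat * gint) :=
  [seq t <- flatten [seq rcons
       [seq (b, Some k, lcoef (lwedge (lom k) [:: ((1, 0), b)]) u) | k <- iota 0 6]
       (b, None, lcoef (ldbasis b) u) | b <- p0_bits p] | t.2 != (0, 0)].

Definition ord_of (k : nat) : 'I_6 :=
  match k with 0 => 0 | 1 => 1 | 2 => 2 | 3 => 3 | 4 => 4 | _ => 5 end.

Definition dform_term (R : realType) (a : cform R) (x : pt R) (t : bits * option nat * gint) : R[i] :=
  (if t.1.2 is Some k then Wfield (ord_of k) (a (setb t.1.1)) x else quarter R * a (setb t.1.1) x)
  * gval R t.2.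

Lemma form_p0_eq0 (R : realType) p (a : cform R) b : is_form_pq p 0 a ->
  size b = 6%N -> b \notin p0_bits p -> a (setb b) = fun=> 0.
Proof.
move=> [_ a0] sb bp; apply/boolp.funext => x; apply: a0.
have [-> ->] := pqdeg_setb b sb.
by move: bp; rewrite mem_filter mem_all_bits sb eqxx andbT negb_and.
Qed.

Lemma dform_p0 (R : realType) p (a : cform R) u x : is_form_pq p 0 a -> size u = 6%N ->
  dform a (setb u) x = \sum_(b <- p0_bits p)
    (\sum_(k <- ord6) Wfield k (a (setb b)) x * gval R (lcoef (lwedge (lom k) [:: ((1, 0), b)]) u)
     + a (setb b) x * (quarter R * gval R (lcoef (ldbasis b) u))).
Proof.
move=> fa su; rewrite dform_setb // big_filter [RHS]big_mkcond /=.
apply: eq_big_seq => b; rewrite mem_all_bits => /eqP sb.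
case: ifPn => [//|bp].
rewrite (form_p0_eq0 R p a b fa sb); last first.
  by rewrite mem_filter (negbTE bp).
rewrite mul0r addr0; apply: big1 => k _; by rewrite Wfield_cst mul0r.
Qed.

Lemma gval0 (R : realType) : gval R (0, 0) = 0.
Proof. by rewrite /gval /= mulr0 addr0. Qed.

(** With the list [ts] as a parameter, each use checks it by [vm_compute] and obtains one scalar
    equation containing only terms with nonzero coefficient. *)
Lemma H_Dol_p0_terms (R : realType) p (a : cform R) u x ts : H_Dol_p0 p a -> size u = 6%N ->
  dbar_mubar_bits p u -> dform_terms p u = ts ->
  foldr (fun t s => dform_term R a x t + s) 0 ts = 0.
Proof.
move=> [fa [db mb]] su pu <-.
have D : dform a (setb u) x = 0.
  have [pp qq] := pqdeg_setb u su.
  case/orP: pu => [H|/andP[H1 H2]]; first by have := db (setb u) x; rewrite /dbar pp qq H.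
  by have := mb (setb u) x; rewrite /mubar pp qq H1 H2.
rewrite -[RHS]D (dform_p0 _ p) //.
transitivity (\sum_(t <- dform_terms p u) dform_term R a x t).
  elim: (dform_terms p u) => [|t s IH]; first by rewrite big_nil.
  by rewrite big_cons -IH.
(* The terms dropped from [dform_terms] have coefficient 0, so restoring them does not change the
   sum. *)
rewrite big_filter big_mkcond big_flatten big_map; apply: eq_bigr => b _.
rewrite -cats1 big_cat big_seq1 big_map /=; congr (_ + _).
  rewrite !big_cons !big_nil /=.
  by do ! (congr (_ + _); first by rewrite /dform_term /=; case: eqP => [->|//]; rewrite gval0 mulr0).
rewrite /dform_term /= mulrA (mulrC (quarter R)).
by case: eqP => [->|//]; rewrite gval0 mulr0.
Qed.

(** A Boolean certificate that [L] represents a Dolbeault class. Constant coefficients have zero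
    frame derivatives, so d is given by the [ldbasis] terms; their common factor [quarter] is left
    out. *)
Definition lform_closed (p : nat) (L : lform) : bool :=
  [&& lwf L, all (fun b => (b \in p0_bits p) || (lcoef L b == (0, 0))) (all_bits 6) &
    all (fun u => dbar_mubar_bits p u ==>
      (foldr (fun b s => gadd (gmul (lcoef L b) (lcoef (ldbasis b) u)) s) (0, 0) (p0_bits p) == (0, 0)))
    (all_bits 6)].

Lemma set_bitsP (P : {set 'I_6} -> Prop) :
  (forall b, b \in all_bits 6 -> size b = 6%N -> P (setb b)) -> forall S, P S.
Proof.
move=> H S; rewrite -(bits_ofK S); apply: H; last exact: size_bits_of.
by rewrite mem_all_bits size_bits_of.
Qed.

Lemma smoothR_cst (R : realType) (c : R) : smoothR (fun _ : pt R => c).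
Proof.
move=> s p.
suff [d ->] : exists d : R, iter_pd s (fun=> c) = fun=> d by exact: differentiable_cst.
elim: s => [|i s [d IH]] /=; first by exists c.
by exists 0; rewrite IH pdR_cst.
Qed.

Lemma gval_foldr (R : realType) (T : Type) (g : T -> gint) (s : seq T) :
  gval R (foldr (fun b r => gadd (g b) r) (0, 0) s) = \sum_(b <- s) gval R (g b).
Proof. by elim: s => [|b s IH]; rewrite ?big_nil ?gval0 //= gvalD IH big_cons. Qed.

Lemma H_Dol_lform (R : realType) p (L : lform) (a : cform R) c : lform_closed p L ->
  (forall S x, a S x = c * lfval R L S x) -> H_Dol_p0 p a.
Proof.
move=> /and3P [wL /allP Lb /allP Ld] aE.
have aS b : size b = 6%N -> a (setb b) = fun=> c * gval R (lcoef L b).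
  by move=> sb; apply/boolp.funext => x; rewrite aE lfval_coef.
have fa : is_form_pq p 0 a.
  split; apply: set_bitsP => b bb sb; rewrite aS //.
    by split => //; split; exact: smoothR_cst.
  have [-> ->] := pqdeg_setb b sb => bp x.
  have := Lb b bb; rewrite mem_filter bb andbT -negb_and in bp *.
  by rewrite (negbTE bp) /= => /eqP ->; rewrite gval0 mulr0.
have da u x : u \in all_bits 6 -> dbar_mubar_bits p u -> dform a (setb u) x = 0.
  move=> uu up; have su : size u = 6%N by apply/eqP; rewrite -mem_all_bits.
  have := Ld u uu; rewrite up /= => /eqP E.
  rewrite (dform_p0 _ p) //.
  transitivity (c * quarter R * gval R (0, 0)); last by rewrite gval0 mulr0.
  rewrite -[in RHS]E gval_foldr mulr_sumr; apply: eq_big_seq => b.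
  rewrite mem_filter mem_all_bits => /andP[_ /eqP sb].
  rewrite aS // big1 => [|k _]; last by rewrite Wfield_cst mul0r.
  by rewrite add0r gvalM; move: (gval R _) (gval R _) => y z; ring.
split=> //; split; apply: set_bitsP => u uu su x; rewrite /dbar /mubar.
  have [-> ->] := pqdeg_setb u su; case: ifP => // H; apply: da => //.
  by rewrite /dbar_mubar_bits H.
have [-> ->] := pqdeg_setb u su; case: ifP => // H1; case: ifP => // H2; apply: da => //.
by rewrite /dbar_mubar_bits H1 H2 orbT.
Qed.

Lemma form_p0_eq_lform (R : realType) p (L : lform) (a : cform R) c : lform_closed p L ->
  is_form_pq p 0 a -> (forall b x, b \in p0_bits p -> a (setb b) x = c * gval R (lcoef L b)) ->
  forall S x, a S x = c * lfval R L S x.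
Proof.
move=> /and3P [wL /allP Lb _] fa H; apply: set_bitsP => b bb sb x; rewrite lfval_coef //.
case: (boolP (b \in p0_bits p)) => [|bp]; first exact: H.
rewrite (form_p0_eq0 R p a b fa sb bp).
by have := Lb b bb; rewrite (negbTE bp) /= => /eqP ->; rewrite gval0 mulr0.
Qed.

Definition lphi3 : lform := lom 2.
Definition lpsi2 : lform :=
  lscale (0, 1) (lwedge (lom 0) (lom 2)) ++ lwedge (lom 1) (lom 2).

Lemma phi3_lform (R : realType) : phi3 R = lfval R lphi3.
Proof. by rewrite /phi3 om_lom inordK. Qed.

Lemma psi2_lform (R : realType) : psi2 R = lfval R lpsi2.
Proof. by rewrite /psi2 !om_lom !inordK // lfval_cat lfval_scale !lfval_wedge gval_i. Qed.

Lemma lphi3_closed : lform_closed 1 lphi3. Proof. by vm_compute. Qed.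
Lemma lpsi2_closed : lform_closed 2 lpsi2. Proof. by vm_compute. Qed.
Lemma lform0_closed : lform_closed 3 [::]. Proof. by vm_compute. Qed.

Lemma gval1 (R : realType) : gval R (1, 0) = 1.
Proof. by rewrite /gval /= mulr0 addr0. Qed.

Definition gvalE := (gval0, gval1, gval_m1, gval_i, gval_mi).

Lemma quarter_neq0 (R : realType) : quarter R != 0.
Proof. by rewrite /quarter /halfC mulf_neq0 // invr_eq0 pnatr_eq0. Qed.

(* Solving the component equations degree by degree *)
Local Opaque Wfield quarter gval.

(** Write [f k] for the coefficient of phi^(k+1). Once [f 1] is known to be constant, it is the
    source in the equations for [f 2], and [W_const] admits no nonzero source. *)
Lemma H_Dol_1_const (R : realType) (a : cform R) : H_Dol_p0 1 a ->
  exists c : R[i], forall S x, a S x = c * phi3 R S x.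
Proof.
move=> Ha; have fa := Ha.1.
pose f k := a (setb (bits_in [:: k])).
have E l x ts Hs Hd Ht := H_Dol_p0_terms R 1 a (bits_in l) x ts Ha Hs Hd Ht.
(* The index set 3, 5 stands for conj phi^1 ^ conj phi^3, of bidegree (0, 2): this is a mubar
   equation, free of derivatives. *)
have f01 x : f 0%N x = 'i%C * f 1%N x.
  have := E [:: 3; 5]%N x [:: (bits_in [:: 0%N], None, (1, 0)); (bits_in [:: 1%N], None, (0, -1))]
    erefl erefl ltac:(by vm_compute).
  rewrite /= /dform_term /= !gvalE mulr1 addr0 mulrN => /eqP; rewrite subr_eq0 => /eqP H.
  by apply: (mulfI (quarter_neq0 R)); rewrite H mulrCA mulrC.
have W13 x : Wfield 3 (f 1%N) x = 0.
  have := E [:: 1; 3]%N x [:: (bits_in [:: 1%N], Some 3%N, (-1, 0))]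
    erefl erefl ltac:(by vm_compute).
  by rewrite /= /dform_term /= gvalE addr0 mulrN1 => /eqP; rewrite oppr_eq0 => /eqP.
have W14 x : Wfield 4 (f 1%N) x = 0.
  have := E [:: 1; 4]%N x [:: (bits_in [:: 1%N], Some 4%N, (-1, 0))]
    erefl erefl ltac:(by vm_compute).
  by rewrite /= /dform_term /= gvalE addr0 mulrN1 => /eqP; rewrite oppr_eq0 => /eqP.
have W15 x : Wfield 5 (f 1%N) x = 0.
  have := E [:: 1; 5]%N x [:: (bits_in [:: 0%N], None, (0, -1));
     (bits_in [:: 1%N], Some 5%N, (-1, 0)); (bits_in [:: 1%N], None, (-1, 0))]
    erefl erefl ltac:(by vm_compute).
  rewrite /= /dform_term /= !gvalE addr0 !mulrN1 -/(f 0%N) -/(f 1%N) f01.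
  move: (quarter R) (f 1%N x) (Wfield 5 (f 1%N) x) => q y w.
  (* The mubar relation [f01] turns the zeroth-order contribution of [f 0] into the opposite of that
     of [f 1], leaving only the derivative. *)
  have -> : q * ('i%C * y) * - 'i%C = - ('i%C * 'i%C) * (q * y) by ring.
  by rewrite mulii opprK mul1r addrCA subrr addr0 => /eqP; rewrite oppr_eq0 => /eqP.
have [_ _ f1c] := W_const (f 1%N) 0 0 (fa.1 _).1 (fa.1 _).2 W13 W14 W15.
have W23 x : Wfield 3 (f 2%N) x = quarter R * 2%:R * 'i%C * f 1%N 0.
  have := E [:: 2; 3]%N x [:: (bits_in [:: 0%N], None, (1, 0));
     (bits_in [:: 1%N], None, (0, 1)); (bits_in [:: 2%N], Some 3%N, (-1, 0))]
    erefl erefl ltac:(by vm_compute).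
  rewrite /= /dform_term /= !gvalE addr0 mulr1 mulrN1 -/(f 0%N) -/(f 1%N) -/(f 2%N) f01 f1c.
  move: (quarter R) (f 1%N 0) (Wfield 3 (f 2%N) x) => q y w.
  by rewrite addrA => /eqP; rewrite subr_eq0 => /eqP <-; ring.
have W24 x : Wfield 4 (f 2%N) x = - (quarter R * 2%:R * f 1%N 0).
  have := E [:: 2; 4]%N x [:: (bits_in [:: 0%N], None, (0, 1));
     (bits_in [:: 1%N], None, (-1, 0)); (bits_in [:: 2%N], Some 4%N, (-1, 0))]
    erefl erefl ltac:(by vm_compute).
  rewrite /= /dform_term /= !gvalE addr0 !mulrN1 -/(f 0%N) -/(f 1%N) -/(f 2%N) f01 f1c.
  move: (quarter R) (f 1%N 0) (Wfield 4 (f 2%N) x) => q y w.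
  have -> : q * ('i%C * y) * 'i%C = ('i%C * 'i%C) * (q * y) by ring.
  by rewrite mulii addrA => /eqP; rewrite subr_eq0 => /eqP <-; ring.
have W25 x : Wfield 5 (f 2%N) x = 0.
  have := E [:: 2; 5]%N x [:: (bits_in [:: 2%N], Some 5%N, (-1, 0))]
    erefl erefl ltac:(by vm_compute).
  by rewrite /= /dform_term /= gvalE addr0 mulrN1 => /eqP; rewrite oppr_eq0 => /eqP.
have [_ c4 f2c] := W_const (f 2%N) _ _ (fa.1 _).1 (fa.1 _).2 W23 W24 W25.
(* [c4] says that the constant W_4-derivative of [f 2], namely minus half of [f 1], is zero. *)
have f10 : f 1%N 0 = 0.
  have n0 : quarter R * 2%:R != 0 by rewrite mulf_neq0 ?quarter_neq0 ?pnatr_eq0.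
  by apply: (mulfI n0); rewrite mulr0; apply/eqP; rewrite -oppr_eq0 c4.
exists (f 2%N 0); rewrite phi3_lform; apply: (form_p0_eq_lform _ _ _ _ _ lphi3_closed fa) => b x.
have -> : p0_bits 1 = [:: bits_in [:: 0%N]; bits_in [:: 1%N]; bits_in [:: 2%N]] by vm_compute.
rewrite !inE => /or3P [] /eqP ->.
- have -> : lcoef lphi3 (bits_in [:: 0%N]) = (0, 0) by vm_compute.
  by rewrite gvalE mulr0 -/(f 0%N) f01 f1c f10 mulr0.
- have -> : lcoef lphi3 (bits_in [:: 1%N]) = (0, 0) by vm_compute.
  by rewrite gvalE mulr0 -/(f 1%N) f1c f10.
- have -> : lcoef lphi3 (bits_in [:: 2%N]) = (1, 0) by vm_compute.
  by rewrite gvalE mulr1 -/(f 2%N) f2c.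
Qed.

(** The mubar equations kill the coefficient of phi^1 ^ phi^2 and tie the other two by the factor i.
    The zeroth-order terms of dbar then cancel, so the single remaining function is constant. *)
Lemma H_Dol_2_const (R : realType) (a : cform R) : H_Dol_p0 2 a ->
  exists c : R[i], forall S x, a S x = c * psi2 R S x.
Proof.
move=> Ha; have fa := Ha.1.
pose f k l := a (setb (bits_in [:: k; l])).
have E l x ts Hs Hd Ht := H_Dol_p0_terms R 2 a (bits_in l) x ts Ha Hs Hd Ht.
have f01 x : f 0%N 1%N x = 0.
  have := E [:: 0; 4; 5]%N x [:: (bits_in [:: 0; 1]%N, None, (1, 0))]
    erefl erefl ltac:(by vm_compute).
  rewrite /= /dform_term /= !gvalE mulr1 addr0 => H.
  by apply: (mulfI (quarter_neq0 R)); rewrite mulr0.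
have f02 x : f 0%N 2%N x = 'i%C * f 1%N 2%N x.
  have := E [:: 2; 3; 5]%N x [:: (bits_in [:: 0; 2]%N, None, (1, 0));
    (bits_in [:: 1; 2]%N, None, (0, -1))] erefl erefl ltac:(by vm_compute).
  rewrite /= /dform_term /= !gvalE mulr1 addr0 mulrN => /eqP; rewrite subr_eq0 => /eqP H.
  by apply: (mulfI (quarter_neq0 R)); rewrite H mulrCA mulrC.
have W3 x : Wfield 3 (f 1%N 2%N) x = 0.
  have := E [:: 1; 2; 3]%N x [:: (bits_in [:: 0; 1]%N, None, (1, 0));
     (bits_in [:: 1; 2]%N, Some 3%N, (1, 0))] erefl erefl ltac:(by vm_compute).
  by rewrite /= /dform_term /= !gvalE addr0 !mulr1 -/(f 0%N 1%N) f01 mulr0 add0r.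
have W4 x : Wfield 4 (f 1%N 2%N) x = 0.
  have := E [:: 1; 2; 4]%N x [:: (bits_in [:: 0; 1]%N, None, (0, 1));
     (bits_in [:: 1; 2]%N, Some 4%N, (1, 0))] erefl erefl ltac:(by vm_compute).
  by rewrite /= /dform_term /= !gvalE addr0 !mulr1 -/(f 0%N 1%N) f01 mulr0 mul0r add0r.
have W5 x : Wfield 5 (f 1%N 2%N) x = 0.
  have := E [:: 1; 2; 5]%N x [:: (bits_in [:: 0; 2]%N, None, (0, 1));
     (bits_in [:: 1; 2]%N, Some 5%N, (1, 0)); (bits_in [:: 1; 2]%N, None, (1, 0))]
    erefl erefl ltac:(by vm_compute).
  rewrite /= /dform_term /= !gvalE addr0 !mulr1 -/(f 0%N 2%N) -/(f 1%N 2%N) f02.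
  move: (quarter R) (f 1%N 2%N x) (Wfield 5 (f 1%N 2%N) x) => q y w.
  have -> : q * ('i%C * y) * 'i%C = ('i%C * 'i%C) * (q * y) by ring.
  by rewrite mulii mulN1r addrCA addNr addr0.
have [_ _ fc] := W_const (f 1%N 2%N) 0 0 (fa.1 _).1 (fa.1 _).2 W3 W4 W5.
exists (f 1%N 2%N 0); rewrite psi2_lform; apply: (form_p0_eq_lform _ _ _ _ _ lpsi2_closed fa) => b x.
have -> : p0_bits 2 = [:: bits_in [:: 0; 1]%N; bits_in [:: 0; 2]%N; bits_in [:: 1; 2]%N].
  by vm_compute.
rewrite !inE => /or3P [] /eqP ->.
- have -> : lcoef lpsi2 (bits_in [:: 0; 1]%N) = (0, 0) by vm_compute.
  by rewrite gvalE mulr0 -/(f 0%N 1%N) f01.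
- have -> : lcoef lpsi2 (bits_in [:: 0; 2]%N) = (0, 1) by vm_compute.
  by rewrite gvalE -/(f 0%N 2%N) f02 fc mulrC.
- have -> : lcoef lpsi2 (bits_in [:: 1; 2]%N) = (1, 0) by vm_compute.
  by rewrite gvalE mulr1 -/(f 1%N 2%N) fc.
Qed.

(** A single mubar component decides: on the index set 0, 2, 3, 5 it is i/4 times the coefficient of
    phi^123, and it comes from mubar phi^2. *)
Lemma H_Dol_3_eq0 (R : realType) (a : cform R) : H_Dol_p0 3 a -> forall S x, a S x = 0.
Proof.
move=> Ha; have fa := Ha.1.
suff aE : forall S x, a S x = 0 * lfval R [::] S x by move=> S x; rewrite aE mul0r.
apply: (form_p0_eq_lform _ _ _ _ _ lform0_closed fa) => b x.
have -> : p0_bits 3 = [:: bits_in [:: 0; 1; 2]%N] by vm_compute.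
rewrite inE => /eqP ->; rewrite mul0r.
have := H_Dol_p0_terms R 3 a (bits_in [:: 0; 2; 3; 5]%N) x
  [:: (bits_in [:: 0; 1; 2]%N, None, (0, 1))] Ha erefl erefl ltac:(by vm_compute).
rewrite /= /dform_term /= !gvalE addr0 => H.
apply: (mulfI (quarter_neq0 R)); move: H; set y := quarter R * _ => H.
have -> : y = - (y * 'i%C * 'i%C) by rewrite -mulrA mulii mulrN1 opprK.
by rewrite H mul0r oppr0 mulr0.
Qed.

Theorem mainTheorem11 (R : realType) :
  (forall a : cform R, H_Dol_p0 1 a <->
     exists c : R[i], forall S x, a S x = c * phi3 R S x) /\
  (forall a : cform R, H_Dol_p0 2 a <->
     exists c : R[i], forall S x, a S x = c * psi2 R S x) /\
  (forall a : cform R, H_Dol_p0 3 a <-> forall S x, a S x = 0).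
Proof.
split; [|split] => a; split.
- exact: H_Dol_1_const.
- by case=> c; rewrite phi3_lform; exact: (H_Dol_lform _ _ _ _ c lphi3_closed).
- exact: H_Dol_2_const.
- by case=> c; rewrite psi2_lform; exact: (H_Dol_lform _ _ _ _ c lpsi2_closed).
- exact: H_Dol_3_eq0.
- move=> a0; apply: (H_Dol_lform R 3 [::] a 0 lform0_closed) => S x.
  by rewrite a0 mul0r.
Qed.
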